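(* Let $2<p<\infty$ and fix $\rho$ with $1/p<\rho<1/2$. Let $\mathcal L$ be the collection of all triadic intervals, and let $\mu$, $\nu$, the martingale differences $\Delta_I^\nu b$ ($I\in\mathcal L$) and the function $f$ (built with the exponent $\rho$) be as in the context. Then the testing condition holds, i.e. there is a finite constant $B$ with $$\int_J\Bigl(\sum_{I\in\mathcal L,\,I\subset J}|\Delta_I^\nu b|^2\Bigr)^{p/2}d\nu\le B^p\mu(J)\qquad\text{for all } J\in\mathcal L,$$ but $f\in L^p(\mu)$ and $$\int_{\mathbb R}\Bigl(\sum_{I\in\mathcal L}|\langle f\rangle_{I,\mu}|^2\,|\Delta_I^\nu b|^2\Bigr)^{p/2}d\nu=\infty,$$ so that there is no finite constant $A$ for which $\int_{\mathbb R}\bigl(\sum_{I\in\mathcal L}|\langle g\rangle_{I,\mu}|^2|\Delta_I^\nu b|^2\bigr)^{p/2}d\nu\le A^p\|g\|_{L^p(\mu)}^p$ holds for all $g\in L^p(\mu)$.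
   Context: Triadic intervals: $I_k^n=3^{-n}[k,k+1)$, $k,n\in\mathbb Z$; $\mathcal L$ is the set of all of them. The averages are $\langle f\rangle_{I,\mu}=\mu(I)^{-1}\int_I f\,d\mu$, with $\langle f\rangle_{I,\mu}=0$ if $\mu(I)=0$. For $n\ge0$ let $C_n=\bigcup [x,x+3^{-n})$, the union being over all $x=\sum_{j=1}^n\varepsilon_j3^{-j}$ with $\varepsilon_j\in\{0,2\}$; so $C_0=[0,1)$, $C_1=[0,1/3)\cup[2/3,1)$, and $C_n$ is a disjoint union of $2^n$ triadic intervals of length $3^{-n}$. Put $D_n=C_{n-1}\setminus C_n$ for $n\ge1$. The measure $\mu$ is Lebesgue measure restricted to $[0,1)$; $\nu$ is the Cantor probability measure: for $n\ge0$ and a triadic interval $I$ of length $3^{-n}$, $\nu(I)=2^{-n}$ if $I\subset C_n$ and $\nu(I)=0$ otherwise. The symbol $b$ is given by its martingale differences: for $n\ge0$ and a triadic interval $I\subset C_n$ of length $3^{-n}$, with right and left thirds $I_+$ and $I_-$, set $\Delta_I^\nu b=(2/3)^{n/p}(\mathbf 1_{I_+}-\mathbf 1_{I_-})$; for all other triadic intervals $I$, $\Delta_I^\nu b=0$. The function is $f=\sum_{n\ge1}(3/2)^{n/p}n^{-\rho}\mathbf 1_{D_n}$. *)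

(* Defs.v *)
From HB Require Import structures.
From mathcomp Require Import all_boot all_order all_algebra.
From mathcomp Require Import all_classical all_reals all_analysis.
From mathcomp Require Import measurable_realfun ring lra zify.
Set Implicit Arguments.
Unset Strict Implicit.
Unset Printing Implicit Defensive.
Import Order.TTheory GRing.Theory Num.Theory.
Import numFieldNormedType.Exports.
Local Open Scope classical_set_scope.
Local Open Scope ring_scope.

(* A triadic interval I_k^n is represented by the pair (n, k) : int * int.
   Distinct pairs give distinct intervals, so sums over a collection of triadic
   intervals are sums over the corresponding set of pairs. *)
Definition triadic {R : realType} (I : int * int) : set R :=
  `[3 ^ (- I.1) * I.2%:~R, 3 ^ (- I.1) * (I.2 + 1)%:~R[.

Definition left_third (I : int * int) : int * int := (I.1 + 1, 3 * I.2).
Definition right_third (I : int * int) : int * int := (I.1 + 1, 3 * I.2 + 2).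

Definition cantor_endpoint {R : realType} (n : nat) (e : nat -> R) : R :=
  \sum_(1 <= j < n.+1) e j * 3 ^- j.

Definition cantor_approx {R : realType} (n : nat) : set R :=
  \bigcup_(e in [set e : nat -> R | forall j, e j = 0 \/ e j = 2])
    `[cantor_endpoint n e, cantor_endpoint n e + 3 ^- n[%classic.

Definition cantor_gap {R : realType} (n : nat) : set R :=
  cantor_approx n.-1 `\` cantor_approx n.

Definition mu01 {R : realType} : set (measurableTypeR R) -> \bar R :=
  mrestr lebesgue_measure (measurable_itv `[(0 : R), 1[).
HB.instance Definition _ (R : realType) := Measure.on (@mu01 R).

(* These values determine a Borel measure on R uniquely, since the triadic
   intervals of length at most 1 form a pi-system generating the Borel sets. *)
Definition cantor_law {R : realType} (nu : set (measurableTypeR R) -> \bar R) :=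
  forall (n : nat) (k : int),
    nu (triadic (n%:Z, k)) =
    (if `[< (triadic (n%:Z, k) : set R) `<=` cantor_approx n >]
     then (2 ^- n)%:E else 0)%E.

Definition average {R : realType}
    (m : {measure set (measurableTypeR R) -> \bar R}) (f : R -> R) (I : set R) : R :=
  if m I == 0%E then 0 else (fine (m I))^-1 * \int[m]_(x in I) f x.

Definition mdiff_b {R : realType} (p : R) (I : int * int) (x : R) : R :=
  if I.1 is Posz n then
    if `[< (triadic I : set R) `<=` cantor_approx n >]
    then (2 / 3) `^ (n%:R / p) *
         (\1_(triadic (right_third I)) x - \1_(triadic (left_third I)) x)
    else 0
  else 0.

(* The sets cantor_gap n, n >= 1, are pairwise disjoint, so the partial sums
   are eventually constant at every point. *)
Definition gap_fun {R : realType} (p rho : R) (x : R) : R :=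
  limn (fun N => \sum_(1 <= n < N)
    (3 / 2) `^ (n%:R / p) * n%:R `^ (- rho) * \1_(cantor_gap n) x).

(* The Cantor measure is obtained as the image of Lebesgue measure on [0, 1[
   under psi : \sum_j d_j 2^-j |-> \sum_j 2 d_j 3^-j (binary digits d_j). *)
Section cantor_law_exists.
Context {R : realType}.
Implicit Types (t : R) (e : nat -> R) (n m : nat).

Let phi := fix phi m t : R := if m is m'.+1 then
  (if t < 2^-1 then phi m' (2 * t) / 3 else (2 + phi m' (2 * t - 1)) / 3)
  else 0.

Let phi_bound m t : 0 <= phi m t <= 1.
Proof.
elim: m t => [|m IH] t /=; first by rewrite lexx ler01.
case: ifP => _; first by have := IH (2 * t); lra.
by have := IH (2 * t - 1); lra.
Qed.

Let phi_incr m t : phi m t <= phi m.+1 t.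
Proof.
elim: m t => [|m IH] t; first by have /andP[] := phi_bound 1 t.
rewrite [leLHS]/= [leRHS]/=; case: ifP => _.
  by have := IH (2 * t); rewrite /=; lra.
by have := IH (2 * t - 1); rewrite /=; lra.
Qed.

Let is_cvg_phi t : cvgn (phi^~ t).
Proof.
apply: nondecreasing_is_cvgn.
  by apply/nondecreasing_seqP => m; exact: phi_incr.
by exists 1 => _ [m _ <-]; have /andP[] := phi_bound m t.
Qed.

Let psi t := limn (phi^~ t).

Let psi_rec t :
  psi t = if t < 2^-1 then psi (2 * t) / 3 else (2 + psi (2 * t - 1)) / 3.
Proof.
rewrite {1}/psi; apply/cvg_lim => //.
rewrite -cvg_shiftS /=; case: ifP => _.
  by apply: cvgMl; exact: is_cvg_phi.
by apply: cvgMl; apply: cvgD; [exact: cvg_cst|exact: is_cvg_phi].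
Qed.

Let psi_bound t : 0 <= psi t <= 1.
Proof.
apply/andP; split.
  by apply: limr_ge; [exact: is_cvg_phi|near=> m; have /andP[] := phi_bound m t].
by apply: limr_le; [exact: is_cvg_phi|near=> m; have /andP[] := phi_bound m t].
Unshelve. all: end_near. Qed.

Let psi_lt1 t : t < 1 -> psi t < 1.
Proof.
move=> t1.
have [m] : exists m, t <= 1 - 2 ^- m.
  have : 2^-1 ^+ m @[m --> \oo] --> (0 : R).
    by apply: cvg_expr; rewrite ger0_norm; lra.
  have t0 : 0 < 1 - t by lra.
  move=> /cvgrPdist_lt /(_ _ t0) [m _ /(_ m (leqnn m))] /= H.
  exists m; move: H; rewrite sub0r normrN exprVn ger0_norm ?invr_ge0 ?exprn_ge0//.
  by lra.
elim: m t {t1} => [|m IH] t tm; rewrite psi_rec.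
  rewrite expr0 invr1 subrr in tm.
  by have := psi_bound (2 * t); case: ifP; lra.
case: ifP => t2; first by have := psi_bound (2 * t); lra.
have : psi (2 * t - 1) < 1.
  by apply: IH; move: tm; rewrite exprS invfM; lra.
lra.
Qed.

Let mpsi : measurable_fun setT psi.
Proof.
apply: (@measurable_fun_cvg _ _ _ _ (fun m t => phi m t)) => [m|t _]; last first.
  exact: is_cvg_phi.
elim: m => [|m IH] /=; first exact: measurable_cst.
apply: measurable_fun_if => //.
- by apply: measurable_fun_ltr.
- apply: measurable_funTS; apply: measurable_funM => //.
  apply: (measurableT_comp IH); exact: measurable_funM.
- apply: measurable_funTS; apply: measurable_funM => //.
  apply: measurable_funD => //; apply: (measurableT_comp IH).
  by apply: measurable_funB => //; exact: measurable_funM.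
Qed.

Let digits e := forall j, e j = 0 \/ e j = 2.

Let ep_rec n e : cantor_endpoint n.+1 e =
  (e 1 + cantor_endpoint n (e \o S)) / 3.
Proof.
rewrite /cantor_endpoint big_ltn// big_add1/= mulrDl expr1; congr (_ + _).
by rewrite mulr_suml; apply: eq_bigr => j _; rewrite exprS invfM; lra.
Qed.

Let dy n e := \sum_(1 <= j < n.+1) (e j / 2) * 2 ^- j.

Let dy_rec n e : dy n.+1 e = (e 1 / 2 + dy n (e \o S)) / 2.
Proof.
rewrite /dy big_ltn// big_add1/= mulrDl expr1; congr (_ + _).
by rewrite mulr_suml; apply: eq_bigr => j _; rewrite exprS invfM; lra.
Qed.

Let ep0 e : cantor_endpoint 0 e = 0.
Proof. by rewrite /cantor_endpoint big_geq. Qed.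

Let dy0 e : dy 0 e = 0.
Proof. by rewrite /dy big_geq. Qed.

Let ep_bound n e : digits e ->
  0 <= cantor_endpoint n e /\ cantor_endpoint n e + 3 ^- n <= 1.
Proof.
elim: n e => [|n IH] e he; first by rewrite ep0 expr0 invr1; lra.
have [] := IH (e \o S) (fun j => he j.+1).
by rewrite ep_rec exprS invfM; case: (he 1) => ->; lra.
Qed.

Let dy_bound n e : digits e -> 0 <= dy n e /\ dy n e + 2 ^- n <= 1.
Proof.
elim: n e => [|n IH] e he; first by rewrite dy0 expr0 invr1; lra.
have [] := IH (e \o S) (fun j => he j.+1).
by rewrite dy_rec exprS invfM; case: (he 1) => ->; lra.
Qed.

Let psi_ep n e t : digits e -> 0 <= t < 1 ->
  (cantor_endpoint n e <= psi t < cantor_endpoint n e + 3 ^- n)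
  = (dy n e <= t < dy n e + 2 ^- n).
Proof.
elim: n e t => [|n IH] e t he t01.
  rewrite ep0 dy0 !expr0 !invr1; have := psi_bound t.
  by have := @psi_lt1 t; lra.
have [] := ep_bound n (fun j => he j.+1); have [] := dy_bound n (fun j => he j.+1).
rewrite ep_rec dy_rec !exprS !invfM psi_rec -/(_ \o _).
set x := cantor_endpoint n _; set y := dy n _ => y0 y1 x0 x1.
have [t2|t2] := ltP t 2^-1.
  have := IH (e \o S) (2 * t) (fun j => he j.+1).
  have := psi_bound (2 * t); have := @psi_lt1 (2 * t).
  rewrite -/x -/y; move: t2; case: (he 1) => -> t2 P Q K.
    apply/idP/idP.
      by move=> H; have := K; lra.
    by move=> H; have := K; lra.
  by apply/idP/idP; lra.
have := IH (e \o S) (2 * t - 1) (fun j => he j.+1).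
have := psi_bound (2 * t - 1); have := @psi_lt1 (2 * t - 1).
rewrite -/x -/y; case: (he 1) => -> P Q K.
  by apply/idP/idP; lra.
apply/idP/idP.
  by move=> H; have := K; lra.
by move=> H; have := K; lra.
Qed.

Let psi_digits n t : 0 <= t < 1 ->
  exists2 e, digits e & cantor_endpoint n e <= psi t < cantor_endpoint n e + 3 ^- n.
Proof.
elim: n t => [|n IH] t t01.
  exists (fun=> 0); first by move=> j; left.
  rewrite ep0 expr0 invr1 add0r; case/andP: (psi_bound t) => -> _ /=.
  by apply: psi_lt1; case/andP: t01.
have [t2|t2] := ltP t 2^-1.
  have [|e he H] := IH (2 * t); first lra.
  exists (fun j => if j is j'.+2 then e j'.+1 else 0).
    by move=> [|[|j]]; [left|left|exact: he].
  rewrite ep_rec psi_rec t2 exprS invfM /=.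
  rewrite (_ : cantor_endpoint n _ = cantor_endpoint n e); first lra.
  by apply: eq_big_nat => -[|j].
have [|e he H] := IH (2 * t - 1); first lra.
exists (fun j => if j is j'.+2 then e j'.+1 else 2).
  by move=> [|[|j]]; [right|right|exact: he].
rewrite ep_rec psi_rec ltNge t2 exprS invfM /=.
rewrite (_ : cantor_endpoint n _ = cantor_endpoint n e); first lra.
by apply: eq_big_nat => -[|j].
Qed.

Let ep_triadic n e : digits e -> exists k : int,
  cantor_endpoint n e = 3 ^ (- n%:Z) * k%:~R.
Proof.
move=> he; elim: n e he => [|n IH] e he; first by exists 0; rewrite ep0 mulr0.
have [k kE] := IH (e \o S) (fun j => he j.+1).
have [a ea] : exists a : int, e 1 = a%:~R.
  by case: (he 1) => ->; [exists 0|exists 2].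
exists (a * 3 ^+ n + k).
rewrite ep_rec kE ea -!exprnN exprS invfM intrD intrM rmorphXn/=.
by field; rewrite expf_neq0.
Qed.

Let triadic_inj n (k l : int) (z : R) :
  triadic (n%:Z, k) z -> triadic (n%:Z, l) z -> k = l.
Proof.
rewrite /triadic /= !in_itv/= -exprnN => /andP[a b] /andP[c d].
have t0 : 0 < (3 : R) ^- n by rewrite invr_gt0 exprn_gt0.
have := le_lt_trans a d; have := le_lt_trans c b.
rewrite !ltr_pM2l// !ltr_int; lia.
Qed.

Let triadic_ep n (k : int) : (triadic (n%:Z, k) : set R) `<=` cantor_approx n <->
  exists2 e, digits e & triadic (n%:Z, k) =
     `[cantor_endpoint n e, cantor_endpoint n e + 3 ^- n[%classic.
Proof.
have t0 : 0 < (3 : R) ^- n by rewrite invr_gt0 exprn_gt0.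
split=> [kC|[e he ->]]; last by move=> x xe; exists e.
have kk : triadic (n%:Z, k) ((3 : R) ^ (- n%:Z) * k%:~R).
  by rewrite /triadic/= in_itv/= lexx/= -exprnN ltr_pM2l// ltr_int; lia.
have [e he eH] := kC _ kk.
exists e => //; have [l lE] := ep_triadic n he.
have lE' : `[cantor_endpoint n e, cantor_endpoint n e + 3 ^- n[%classic
    = triadic (n%:Z, l).
  by rewrite /triadic/= lE intrD mulrDr mulr1 -!exprnN.
by rewrite lE'; congr (triadic (_, _)); apply: (triadic_inj kk); rewrite -lE'.
Qed.

Let mu01T : mu01 [set: measurableTypeR R] = 1%E.
Proof.
rewrite /mu01 /mrestr setTI lebesgue_measure_itv/= lte_fin ltr01.
by rewrite oppr0 adde0.
Qed.

HB.instance Definition _ :=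
  Measure_isProbability.Build _ _ _ (@mu01 R) mu01T.

Lemma cantor_law_exists :
  exists nu : probability (measurableTypeR R) R, cantor_law nu.
Proof.
have psi_mfun : (psi : measurableTypeR R -> measurableTypeR R) \in mfun.
  by rewrite inE; exact: mpsi.
exists (distribution (@mu01 R) (mfun_Sub psi_mfun)) => n k.
rewrite /distribution/= /pushforward /mu01 /mrestr.
case: asboolP => [/triadic_ep[e he kE]|kC].
  rewrite (_ : _ `&` _ = `[dy n e, dy n e + 2 ^- n[%classic).
    rewrite lebesgue_measure_itv/= lte_fin ltrDl invr_gt0 exprn_gt0//.
    by rewrite -EFinB addrAC subrr add0r.
  apply/seteqP; split=> t /=; rewrite kE /= !in_itv/=.
    by move=> [H t01]; rewrite -psi_ep.
  move=> H; have t01 : 0 <= t < 1 by have := dy_bound n he; lra.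
  by split=> //; rewrite psi_ep.
rewrite (_ : _ `&` _ = set0) ?measure0//.
rewrite -subset0 => t /= [tk]; rewrite in_itv/= => t01; apply: kC.
have [e he eH] := psi_digits n t01; apply/triadic_ep; exists e => //.
have [l lE] := ep_triadic n he.
have lE' : `[cantor_endpoint n e, cantor_endpoint n e + 3 ^- n[%classic
    = triadic (n%:Z, l).
  by rewrite /triadic/= lE intrD mulrDr mulr1 -!exprnN.
rewrite lE'; congr (triadic (_, _)); apply: (triadic_inj tk).
by rewrite -lE' /= in_itv.
Qed.

End cantor_law_exists.

(* Main.v *)
Require Import Defs.
From HB Require Import structures.
From mathcomp Require Import all_boot all_order all_algebra.
From mathcomp Require Import all_classical all_reals all_analysis.
From mathcomp Require Import measurable_realfun ring lra zify.
Set Implicit Arguments.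
Unset Strict Implicit.
Unset Printing Implicit Defensive.
Import Order.TTheory GRing.Theory Num.Theory.
Import numFieldNormedType.Exports.
Local Open Scope classical_set_scope.
Local Open Scope ring_scope.

(** The two halves of the statement come from one scaling: an interval of
    generation n that is a constituent of the n-th Cantor approximation has
    nu-mass 2^-n and mu-mass 3^-n, and the square of the martingale difference
    is q^n on its left and right thirds, where q = (2/3)^(2/p).

    Testing condition. Through each point passes one interval per generation,
    so below an interval J of generation n the square sum is at most the
    geometric tail q^n / (1 - q) (square_sum_le). Its power p/2 is a constant
    times (2/3)^n, and (2/3)^n nu(J) <= mu(J) (cantor_law_le_mu01); integrating
    gives testing_condition.

    Divergence. The function is of size (3/2)^(n/p) n^(- rho) on the gap of
    generation n, which has mu-measure comparable to (2/3)^n. Hence its p-th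
    power integrates to a multiple of the convergent series of n^(- rho p)
    (gap_fun_Lfun). Every constituent I of generation n contains a third of its
    length in the next gap, so the average of the function over I is at least
    a third of its value there (average_gap_fun_ge). The growth (3/2)^(n/p)
    cancels the decay of the martingale differences, and at every point of the
    Cantor set the square sum dominates a multiple of the divergent series of
    n^(- 2 rho) (square_function_pinfty). Since the Cantor set has full nu-measure, the
    square function has infinite integral, and the function witnesses that no
    constant A exists. *)

(** * Triadic intervals and Cantor constituents *)

(** With the floor description, uniqueness of the interval of a given
    generation through a point, and nesting of generations, become statements
    about integer parts. *)
Lemma triadicE {R : realType} (m k : int) (x : R) :
  triadic (m, k) x <-> Num.floor (3 ^ m * x) = k.
Proof.
have m0 : 0 < (3 : R) ^ m by exact: exprz_gt0.
have xE : x = 3 ^ (- m) * (3 ^ m * x) by rewrite -invr_expz mulKf// gt_eqF.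
rewrite /triadic /= in_itv /= [in X in X <-> _]xE.
rewrite ler_pM2l ?exprz_gt0// ltr_pM2l ?exprz_gt0//.
by split=> [|<-]; [exact: floor_def | exact: floor_itv].
Qed.

Lemma triadic_child {R : realType} (m k d : int) : 0 <= d <= 2 ->
  (triadic (m + 1, 3 * k + d) : set R) `<=` triadic (m, k).
Proof.
move=> d2 x /triadicE.
rewrite expfzDr// expr1z mulrAC => dE; apply/triadicE/floor_def.
have := floor_itv (3 ^ m * x * 3); rewrite dE !intrD intrM => /andP[a b].
have: (0 <= d%:~R :> R) by rewrite ler0z; lia.
have: (d%:~R <= 2 :> R) by rewrite (ler_int R d 2); lia.
lra.
Qed.

Lemma triadic_childP {R : realType} (m l : int) (x : R) :
  triadic (m + 1, l) x -> triadic (m, (l %/ 3)%Z) x.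
Proof.
rewrite {1}(divz_eq l 3) mulrC; apply: triadic_child; lia.
Qed.

(** The left endpoints 3 ^- n * k of the constituent intervals of the n-th
    Cantor approximation: k runs over the integers with n ternary digits, all
    of them 0 or 2. Working with these integers makes membership decidable and
    turns the thirds of an interval into division by 3. *)
Fixpoint cantor_index (n : nat) : seq int :=
  if n is m.+1 then
    [seq 3 * k | k <- cantor_index m] ++ [seq 3 * k + 2 | k <- cantor_index m]
  else [:: 0].

Lemma size_cantor_index n : size (cantor_index n) = (2 ^ n)%N.
Proof.
by elim: n => //= n IH; rewrite size_cat !size_map IH addnn -mul2n expnS.
Qed.

Lemma cantor_indexS n l : (l \in cantor_index n.+1) =
  ((l %/ 3)%Z \in cantor_index n) && ((l %% 3)%Z != 1).
Proof.
rewrite /= mem_cat; apply/idP/idP.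
  case/orP => /mapP[k kn ->].
    by rewrite (_ : (3 * k %/ 3)%Z = k) ?kn /=; lia.
  by rewrite (_ : ((3 * k + 2) %/ 3)%Z = k) ?kn /=; lia.
move=> /andP[kn l1].
have [l0|l0] := eqVneq (l %% 3)%Z 0; apply/orP; [left|right]; apply/mapP;
  exists (l %/ 3)%Z => //; lia.
Qed.

Lemma cantor_endpointS {R : realType} n (e : nat -> R) :
  cantor_endpoint n.+1 e = cantor_endpoint n e + e n.+1 * 3 ^- n.+1.
Proof. by rewrite /cantor_endpoint big_nat_recr. Qed.

Lemma cantor_endpoint_child {R : realType} n (k d : int) (e : nat -> R) :
  cantor_endpoint n e = 3 ^ (- n%:Z) * k%:~R -> e n.+1 = d%:~R ->
  cantor_endpoint n.+1 e = 3 ^ (- n.+1%:Z) * (3 * k + d)%:~R.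
Proof.
move=> eE dE; rewrite cantor_endpointS eE dE -!exprnN exprS invfM intrD intrM.
by field; rewrite expf_neq0.
Qed.

Lemma cantor_endpoint_index {R : realType} n (e : nat -> R) :
  (forall j, e j = 0 \/ e j = 2) ->
  exists2 k, k \in cantor_index n & cantor_endpoint n e = 3 ^ (- n%:Z) * k%:~R.
Proof.
move=> e02; elim: n => [|n [k kn kE]].
  by exists 0; rewrite ?inE// mulr0 /cantor_endpoint big_geq.
have [d d02 dE] : exists2 d : int, (d == 0) || (d == 2) & e n.+1 = d%:~R.
  by case: (e02 n.+1) => ->; [exists 0|exists 2].
exists (3 * k + d); last exact: cantor_endpoint_child.
rewrite cantor_indexS (_ : ((3 * k + d) %/ 3)%Z = k) ?kn /=; lia.
Qed.

(** The digit at position n.+1 is overwritten with the last ternary digit of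
    k; the endpoint of generation n does not look at that position. *)
Lemma cantor_index_endpoint {R : realType} n (k : int) : k \in cantor_index n ->
  exists2 e : nat -> R, forall j, e j = 0 \/ e j = 2 &
    cantor_endpoint n e = 3 ^ (- n%:Z) * k%:~R.
Proof.
elim: n k => [k|n IH k].
  rewrite inE => /eqP ->.
  by exists (fun=> 0); [left|rewrite /cantor_endpoint big_geq// mulr0].
rewrite cantor_indexS => /andP[/IH[e e02 eE] k1].
exists (fun j => if j == n.+1 then (k %% 3)%Z%:~R else e j).
  move=> j; case: eqP => // _.
  have : ((k %% 3)%Z == 0) || ((k %% 3)%Z == 2) by lia.
  by move=> /orP[] /eqP ->; [left|right].
have kE : k = 3 * (k %/ 3)%Z + (k %% 3)%Z by lia.
rewrite [in RHS]kE.
apply: cantor_endpoint_child; rewrite ?eqxx// -eE.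
by apply: eq_big_nat => j /andP[_ jn]; rewrite ifF//; lia.
Qed.

Lemma cantor_approxE {R : realType} n (x : R) :
  cantor_approx n x <-> Num.floor (3 ^+ n * x) \in cantor_index n.
Proof.
have itvE (e : nat -> R) k : cantor_endpoint n e = 3 ^ (- n%:Z) * k%:~R ->
    `[cantor_endpoint n e, cantor_endpoint n e + 3 ^- n[%classic =
    triadic (n%:Z, k).
  by move=> ->; rewrite /triadic/= intrD mulrDr mulr1 -exprnN.
split=> [[e /= /(cantor_endpoint_index n)[k kn /itvE eE]]|].
  rewrite [X in X -> _](_ : _ = triadic (n%:Z, k) x); last by rewrite -eE.
  by move=> /triadicE; rewrite -exprnP => ->.
move=> /(@cantor_index_endpoint R)[e e02 /itvE eE]; exists e => //.
by rewrite eE; apply/triadicE.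
Qed.

Lemma triadic_left {R : realType} (m k : int) :
  triadic (m, k) (3 ^ (- m) * k%:~R : R).
Proof.
by rewrite /triadic/= in_itv/= lexx ltr_pM2l ?exprz_gt0// ltr_int; lia.
Qed.

(** The left endpoint of an interval already decides whether the interval is
    a constituent of the approximation. *)
Lemma triadic_sub_cantor {R : realType} n (k : int) :
  (triadic (n%:Z, k) : set R) `<=` cantor_approx n <-> k \in cantor_index n.
Proof.
split=> [kC|kn x /triadicE xk]; last by apply/cantor_approxE; rewrite xk.
have kk := @triadic_left R n%:Z k.
by have /cantor_approxE := kC _ kk; move/triadicE : kk => ->.
Qed.

Lemma cantor_approxS {R : realType} n :
  cantor_approx n.+1 `<=` (cantor_approx n : set R).
Proof.
move=> x /cantor_approxE; rewrite cantor_indexS => /andP[xn _].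
apply/cantor_approxE; move: xn.
have /triadic_childP/triadicE : triadic (n%:Z + 1, Num.floor (3 ^+ n.+1 * x)) x.
  by apply/triadicE; rewrite -PoszD addn1.
by rewrite -exprnP => ->.
Qed.

Lemma cantor_approx_le {R : realType} m n : (m <= n)%N ->
  cantor_approx n `<=` (cantor_approx m : set R).
Proof.
move=> /subnK <-; elim: (n - m)%N => // d IH.
exact: subset_trans (@cantor_approxS R _) IH.
Qed.

(** * Lebesgue and Cantor masses *)

Lemma measurable_triadic {R : realType} (I : int * int) :
  measurable (triadic I : set (measurableTypeR R)).
Proof. exact: measurable_itv. Qed.

Lemma measurable_cantor_approx {R : realType} n :
  measurable (cantor_approx n : set (measurableTypeR R)).
Proof.
rewrite (_ : cantor_approx n =
    \bigcup_(k in [set` cantor_index n]) triadic (n%:Z, k)).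
  apply: fin_bigcup_measurable => [|k _]; first exact: finite_seq.
  exact: measurable_triadic.
apply/seteqP; split=> x.
  move=> /cantor_approxE xn; exists (Num.floor (3 ^+ n * x)) => //.
  exact/triadicE.
by move=> [k /= kn /triadicE xk]; apply/cantor_approxE; rewrite xk.
Qed.

Lemma measurable_cantor_gap {R : realType} n :
  measurable (cantor_gap n : set (measurableTypeR R)).
Proof. by apply: measurableD; exact: measurable_cantor_approx. Qed.

Lemma cantor_approx0 {R : realType} : cantor_approx 0 = `[0 : R, 1[%classic.
Proof.
apply/seteqP; split=> x.
  move=> /cantor_approxE; rewrite inE expr0 mul1r => /eqP x0.
  by have := floor_itv x; rewrite x0 add0r /= in_itv.
rewrite /= in_itv/= => x01; apply/cantor_approxE.
by rewrite inE expr0 mul1r; apply/eqP/floor_def; rewrite add0r.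
Qed.

Lemma mu01_triadic_itv {R : realType} (n k : int) :
  triadic (n, k) `<=` `[0 : R, 1[%classic ->
  mu01 (triadic (n, k)) = (3 ^ (- n))%:E :> \bar R.
Proof.
move=> n01; rewrite /mu01 /mrestr setIidl// /triadic lebesgue_measure_itv/=.
rewrite lte_fin ltr_pM2l ?exprz_gt0// ltr_int ifT; last lia.
by rewrite -EFinB -mulrBr intrD addrAC subrr add0r mulr1.
Qed.

Lemma mu01_triadic {R : realType} n k : k \in cantor_index n ->
  mu01 (triadic (n%:Z, k)) = (3 ^- n)%:E :> \bar R.
Proof.
move=> /(@triadic_sub_cantor R) kn; rewrite mu01_triadic_itv ?exprnN//.
by rewrite -cantor_approx0; apply: subset_trans kn (cantor_approx_le _).
Qed.

(** Union bound over the 2 ^ n constituents, each of length 3 ^- n. *)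
Lemma mu01_cantor_approx {R : realType} n :
  (mu01 (cantor_approx n : set R) <= ((2 / 3) ^+ n)%:E)%E.
Proof.
have sub (s : seq int) : {subset s <= cantor_index n} ->
    measurable [set x : R | Num.floor (3 ^+ n * x) \in s] /\
    (mu01 [set x : R | Num.floor (3 ^+ n * x) \in s]
     <= ((size s)%:R * 3 ^- n)%:E)%E.
  elim: s => [|k s IH] sn.
    rewrite (_ : [set _ | _] = set0); last by apply/seteqP; split.
    by rewrite measure0 mul0r.
  have [j js|ms les] := IH; first by apply: sn; rewrite inE js orbT.
  rewrite (_ : [set _ | _] = triadic (n%:Z, k) `|`
      [set x : R | Num.floor (3 ^+ n * x) \in s]); last first.
    apply/seteqP; split=> x /=.
      by rewrite inE => /orP[/eqP ?|?]; [left; apply/triadicE|right].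
    rewrite inE => -[/triadicE|->]; last by rewrite orbT.
    by rewrite -exprnP => ->; rewrite eqxx.
  split; first by apply: measurableU => //; exact: measurable_triadic.
  apply: le_trans (measureU2 _ _ _) _ => //; first exact: measurable_triadic.
  rewrite [leLHS]/= mu01_triadic ?sn ?mem_head// [size _]/= -(natr1 (size s)).
  rewrite mulrDl mul1r EFinD addeC.
  exact: leeD2l.
have [//|_] := sub (cantor_index n).
rewrite size_cantor_index exprMn exprVn natrX.
rewrite (_ : [set _ | _] = cantor_approx n)//.
by apply/seteqP; split=> x /cantor_approxE.
Qed.

(** The complement is a countable union of triadic intervals of generation n,
    each of them null because it is not a constituent. *)
Lemma cantor_law_compl {R : realType}
    (nu : {measure set (measurableTypeR R) -> \bar R}) n :
  cantor_law nu -> nu (~` cantor_approx n) = 0%E.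
Proof.
move=> nuC.
have nu0 k : nu.-negligible (if k \in cantor_index n then set0
                              else triadic (n%:Z, k)).
  case: ifPn => [_|kn]; first exact: negligible_set0.
  apply/negligibleP; first exact: (@measurable_triadic R).
  have := nuC n k; rewrite asboolF// => /(@triadic_sub_cantor R).
  by rewrite (negbTE kn).
apply/negligibleP; first by apply: measurableC; exact: measurable_cantor_approx.
apply: negligibleS (negligible_bigcup
  (fun j : nat => negligibleU (nu0 (Posz j)) (nu0 (Negz j)))) => x /= xC.
have xk : triadic (n%:Z, Num.floor (3 ^+ n * (x : R))) (x : R).
  by apply/triadicE.
have kn : Num.floor (3 ^+ n * x) \notin cantor_index n.
  by apply/negP => /(@cantor_approxE R).
case: (Num.floor _) xk kn => j xj jn; exists j => //=.
  by left; rewrite (negbTE jn).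
by right; rewrite (negbTE jn).
Qed.

Lemma cantor_law_bigcap {R : realType} (nu : probability (measurableTypeR R) R) :
  cantor_law nu -> nu (\bigcap_n cantor_approx n) = 1%E.
Proof.
move=> nuC.
have mC : measurable (\bigcap_n cantor_approx n : set (measurableTypeR R)).
  by apply: bigcapT_measurable => n; exact: measurable_cantor_approx.
apply/eqP; rewrite eq_le probability_le1//=.
rewrite -(probability_setT nu) -(setUv (\bigcap_n cantor_approx n)).
apply: le_trans (measureU2 _ _ _) _ => //; first exact: measurableC.
rewrite [X in (_ + X)%E](_ : _ = 0%E) ?adde0//.
apply/negligibleP; first exact: measurableC.
rewrite setC_bigcap; apply: negligible_bigcup => n.
apply/negligibleP; first by apply: measurableC; exact: measurable_cantor_approx.
exact: cantor_law_compl.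
Qed.

(** The scaling relation behind the testing condition. In generation n >= 0,
    a charged interval has nu-mass 2 ^- n and length 3 ^- n; in a negative
    generation (where n = 0) an interval either contains [0, 1) or misses it. *)
Lemma cantor_law_le_mu01 {R : realType} (nu : probability (measurableTypeR R) R)
    (n : nat) (J : int * int) :
  cantor_law nu -> J.1 = n%:Z \/ J.1 < 0 /\ n = 0%N ->
  (nu (triadic J) * ((2 / 3) ^+ n)%:E <= mu01 (triadic J))%E.
Proof.
move: J => [m k] /= nuC [->|[m0 ->]].
  rewrite nuC; case: asboolP => [/triadic_sub_cantor kn|_]; last first.
    by rewrite mul0e.
  rewrite mu01_triadic// -EFinM exprMn exprVn mulrA mulVf ?mul1r//.
rewrite expr0 mule1.
have m3 : 0 < (3 : R) ^ m <= 1.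
  rewrite exprz_gt0//= -(expr0z 3).
  by apply: ler_weXz2l (ltW m0); rewrite ler1n.
have [k0|k0] := eqVneq k 0; last first.
  rewrite (_ : nu _ = 0%E)//; apply/negligibleP; first exact: measurable_triadic.
  exists (~` cantor_approx 0); split.
    by apply: measurableC; exact: measurable_cantor_approx.
    exact: cantor_law_compl.
  move=> x /triadicE xk; rewrite cantor_approx0 /= in_itv/= => /andP[x0 x1].
  move/negP: k0; apply; rewrite -xk; apply/eqP/floor_def; rewrite add0r.
  nra.
apply: le_trans (probability_le1 _ (measurable_triadic _)) _.
rewrite -[leLHS](_ : mu01 (triadic (0%:Z, 0)) = 1%E); last first.
  by rewrite mu01_triadic ?mem_head// expr0 invr1.
apply: le_measure; rewrite ?inE; try exact: measurable_triadic.
move=> x /triadicE; rewrite mul1r => x0; apply/triadicE; rewrite k0.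
have := floor_itv x; rewrite x0 add0r => x01.
by apply/floor_def; rewrite add0r; nra.
Qed.

(** * Martingale differences at a point *)

(** The only triadic interval of generation n containing x. *)
Definition triadic_at {R : realType} (x : R) (n : nat) : int * int :=
  (n%:Z, Num.floor (3 ^+ n * x)).

Lemma triadic_at_inj {R : realType} (x : R) : injective (triadic_at x).
Proof. by move=> m n [] [->]. Qed.

Lemma mdiff_b_neq0 {R : realType} (p : R) (I : int * int) (x : R) :
  mdiff_b p I x != 0 -> exists n, I = triadic_at x n.
Proof.
case: I => -[n|n] k; rewrite /mdiff_b/= ?eqxx//.
case: asboolP => [/triadic_sub_cantor kn|_]; last by rewrite eqxx.
rewrite mulf_eq0 negb_or => /andP[_ b0].
have /triadicE xk : triadic (n%:Z, k) x.
  have [xr|xr] := boolP (x \in triadic (right_third (n%:Z, k))).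
    by move: xr; rewrite inE; apply: triadic_child.
  have [xl|xl] := boolP (x \in triadic (left_third (n%:Z, k))).
    move: xl; rewrite inE /left_third/= -[X in triadic (_, X)]addr0.
    exact: triadic_child.
  by rewrite !indicE (negbTE xr) (negbTE xl) subrr eqxx in b0.
by exists n; rewrite /triadic_at -xk.
Qed.

Lemma powR_divn_sqr {R : realType} (a p : R) n :
  (a `^ (n%:R / p)) ^+ 2 = (a `^ (2 / p)) ^+ n.
Proof.
rewrite -!powR_mulrn ?powR_ge0// -!powRrM; congr (_ `^ _).
by rewrite mulrAC -mulrA mulrC.
Qed.

Lemma mdiff_b_sqr_le {R : realType} (p : R) n k (x : R) :
  `|mdiff_b p (n%:Z, k) x| ^+ 2 <= ((2 / 3) `^ (2 / p)) ^+ n.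
Proof.
rewrite -powR_divn_sqr /mdiff_b/=; case: ifP => _; last first.
  by rewrite normr0 expr0n exprn_ge0// powR_ge0.
rewrite normrM exprMn ger0_norm ?powR_ge0// ler_piMr ?exprn_ge0 ?powR_ge0//.
rewrite expr_le1// !indicE; do 2 case: (_ \in _);
  by rewrite ?subr0 ?sub0r ?subrr ?normrN ?normr1 ?normr0.
Qed.

(** A point of the next approximation lies in the left or the right third of
    its interval, never in the middle one, so exactly one of the two indicator
    functions is 1. *)
Lemma mdiff_b_cantor {R : realType} (p : R) n (x : R) :
  cantor_approx n.+1 x ->
  `|mdiff_b p (triadic_at x n) x| ^+ 2 = ((2 / 3) `^ (2 / p)) ^+ n.
Proof.
move=> /[dup] /cantor_approxS /cantor_approxE xn xS.
rewrite -powR_divn_sqr /mdiff_b/= asboolT; last exact/triadic_sub_cantor.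
rewrite normrM exprMn ger0_norm ?powR_ge0// [X in _ * X](_ : _ = 1) ?mulr1//.
set k := Num.floor (3 ^+ n * x) in xn *.
pose l := Num.floor (3 ^+ n.+1 * x).
have xl : triadic (n%:Z + 1, l) x by apply/triadicE; rewrite -PoszD addn1.
have lk : (l %/ 3)%Z = k.
  by have /triadicE := triadic_childP xl; rewrite -exprnP.
have /cantor_approxE := xS; rewrite -/l cantor_indexS => /andP[_ l1].
have childE d : (x \in triadic (n%:Z + 1, 3 * k + d)) = (l == 3 * k + d).
  apply/idP/eqP => [|lE]; last by rewrite inE -lE.
  by rewrite inE => /triadicE <-; rewrite /l exprnP -(addn1 n) PoszD.
rewrite !indicE /right_third /left_third/= childE.
rewrite -[X in triadic (_, X)](addr0 (3 * k)) childE.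
have : (l == 3 * k + 2) (+) (l == 3 * k + 0) by lia.
by case: eqP => _; case: eqP => _ //= _;
  rewrite ?subr0 ?sub0r ?normrN normr1 expr1n.
Qed.

(** At a fixed point the sums over all triadic intervals are series in the
    generation, which is what makes geometric and harmonic estimates apply. *)
Lemma esum_triadic_at {R : realType} (x : R) (A : set (int * int))
    (F : int * int -> \bar R) :
  (forall I, 0 <= F I)%E ->
  (forall I, F I != 0%E -> exists n, I = triadic_at x n) ->
  (\esum_(I in A) F I =
   \sum_(n <oo | triadic_at x n \in A) F (triadic_at x n))%E.
Proof.
move=> F0 FE; rewrite -(esum_pred_image F) => [|n _//|]; last first.
  by move=> m n _ _; exact: triadic_at_inj.
rewrite esum_mkcond [RHS]esum_mkcond; apply: eq_esum => I _.
have [/eqP|/FE[n ->]] := boolP (F I == 0%E).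
  by move=> ->; rewrite !if_same.
have [nA|nA] := boolP (triadic_at x n \in A).
  by rewrite mem_set//=; exists n.
rewrite memNset//= => -[m /= mA /triadic_at_inj mn].
by rewrite mn (negbTE nA) in mA.
Qed.

Lemma geometric_tail_le {R : realType} (q : R) N M : 0 <= q < 1 ->
  \sum_(0 <= i < M | (N <= i)%N) q ^+ i <= q ^+ N / (1 - q).
Proof.
move=> /andP[q0 q1]; have q1' : 0 < 1 - q by rewrite subr_gt0.
suff -> : \sum_(0 <= i < M | (N <= i)%N) q ^+ i
    = (q ^+ N - q ^+ maxn N M) / (1 - q).
  by rewrite ler_pM2r ?invr_gt0// gerBl exprn_ge0.
elim: M => [|M IH]; first by rewrite big_geq// maxn0 subrr mul0r.
rewrite big_mkcond big_nat_recr//= -big_mkcond IH.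
case: leqP => NM; last by rewrite addr0 !(maxn_idPl _)// ltnW.
rewrite (maxn_idPr (leqW NM)) exprS.
by field; rewrite subr_eq0 gt_eqF.
Qed.

(** * The testing condition *)

Lemma two_thirds_powR_lt1 {R : realType} (r : R) :
  0 < r -> (2 / 3 : R) `^ r < 1.
Proof.
move=> r0; suff : (2 / 3 : R) `^ r < 1 `^ r by rewrite powR1.
by apply: gt0_ltr_powR; rewrite ?nnegrE//; lra.
Qed.

(** The integral of a nonnegative function is a supremum over the simple
    functions below it, so monotonicity is an inclusion of index sets; in this
    form it applies to square functions as they stand. *)
Lemma le_ge0_integral d (T : measurableType d) (R : realType)
    (mu : {measure set T -> \bar R}) (D : set T) (f g : T -> \bar R) :
  (forall x, D x -> 0 <= f x)%E -> (forall x, D x -> f x <= g x)%E ->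
  (\int[mu]_(x in D) f x <= \int[mu]_(x in D) g x)%E.
Proof.
move=> f0 fg; rewrite !(integral_mkcond D).
have g0 x : D x -> (0 <= g x)%E.
  by move=> Dx; apply: le_trans (fg _ Dx); exact: f0.
rewrite !ge0_integralTE; try by move=> x; exact: erestrict_ge0.
apply: ereal_sup_le => _ [h /= hf <-]; exists h => //= x.
by apply: le_trans (hf x) _; exact: lee_restrict.
Qed.

(** If the inner interval were longer, it would contain its left endpoint a
    and also a + 3 ^ (- m), which cannot both lie in a half-open interval of
    length 3 ^ (- m). *)
Lemma triadic_sub_generation {R : realType} (n l m k : int) :
  (triadic (n, l) : set R) `<=` triadic (m, k) -> m <= n.
Proof.
move=> IJ; rewrite leNgt; apply/negP => nm.
have m0 : 0 < (3 : R) ^ (- m) by exact: exprz_gt0.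
have mn : (3 : R) ^ (- m) < 3 ^ (- n).
  by rewrite -!invr_expz ltf_pV2 ?posrE ?exprz_gt0// ltr_eXz2l ?ltr1n.
have /IJ := @triadic_left R n l; set a := 3 ^ (- n) * _ => aJ.
have /IJ : triadic (n, l) (a + 3 ^ (- m)).
  by rewrite /triadic/= in_itv/= intrD mulrDr mulr1 lerDl (ltW m0) ltrD2l.
move: aJ; rewrite /triadic/= !in_itv/= intrD mulrDr mulr1.
lra.
Qed.

(** Generation i contributes at most ((2/3)^(2/p))^i, and only the
    generations i >= n contribute, whence the tail of a geometric series. *)
Lemma square_sum_le {R : realType} (p : R) (n : nat) (J : int * int) (x : R) :
  0 < p -> J.1 = n%:Z \/ J.1 < 0 /\ n = 0%N ->
  (\esum_(I in [set I | (triadic I : set R) `<=` triadic J])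
     (`|mdiff_b p I x| ^+ 2)%:E
   <= (((2 / 3) `^ (2 / p)) ^+ n / (1 - (2 / 3) `^ (2 / p)))%:E)%E.
Proof.
move=> p0 Jn; set q := (2 / 3) `^ (2 / p).
have q01 : 0 <= q < 1.
  by rewrite powR_ge0 two_thirds_powR_lt1 ?divr_gt0.
rewrite (@esum_triadic_at _ x); first last.
- by move=> I; rewrite eqe sqrf_eq0 normr_eq0 => /mdiff_b_neq0.
- by move=> I; rewrite lee_fin exprn_ge0.
apply: lime_le.
  by apply: is_cvg_nneseries => i _ _; rewrite lee_fin exprn_ge0.
apply: nearW => M.
apply: le_trans (_ : (\sum_(0 <= i < M | (n <= i)%N) q ^+ i)%:E <= _)%E; last first.
  by rewrite lee_fin; exact: geometric_tail_le.
rewrite sumEFin lee_fin [leLHS]big_mkcond [leRHS]big_mkcond/=.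
apply: ler_sum => i _; case: ifPn => [|_]; last first.
  by case: ifP => // _; rewrite exprn_ge0//; case/andP: q01.
rewrite inE /= /triadic_at => iJ; rewrite ifT; first exact: mdiff_b_sqr_le.
move: J Jn iJ => [m k]/= Jn /triadic_sub_generation.
by case: Jn => [->|[_ ->]//]; rewrite lez_nat.
Qed.

(** Raising the pointwise bound to the power p/2 turns ((2/3)^(2/p))^n into
    (2/3)^n, precisely the ratio of mu(J) to nu(J) on charged intervals. *)
Lemma testing_condition {R : realType}
    (nu : probability (measurableTypeR R) R) (p : R) :
  cantor_law nu -> 0 < p ->
  exists2 B : R, 0 <= B &
    forall J : int * int,
      (\int[nu]_(x in triadic J)
         (\esum_(I in [set I | (triadic I : set R) `<=` triadic J])
            (`|mdiff_b p I x| ^+ 2)%:E) `^ (p / 2)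
       <= (B `^ p)%:E * mu01 (triadic J))%E.
Proof.
move=> nuC p0; set q := (2 / 3 : R) `^ (2 / p).
have q1 : 0 < 1 - q by rewrite subr_gt0 two_thirds_powR_lt1 ?divr_gt0.
(* B ^ p is the p/2-th power of the sum of the geometric series. *)
exists ((1 - q)^-1 `^ (2^-1)); first exact: powR_ge0.
move=> J.
have [n Jn] : exists n : nat, J.1 = n%:Z \/ J.1 < 0 /\ n = 0%N.
  by case: (J.1) => j; [exists j; left|exists 0%N; right].
apply: le_trans (_ : (\int[nu]_(x in triadic J)
    ((q ^+ n / (1 - q))%:E `^ (p / 2)) <= _)%E).
  apply: le_ge0_integral => x _; first exact: poweR_ge0.
  have esum0 : (0 <= \esum_(I in [set I | (triadic I : set R) `<=` triadic J])
      (`|mdiff_b p I x| ^+ 2)%:E)%E.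
    by apply: esum_ge0 => I _; rewrite lee_fin exprn_ge0.
  apply: gt0_ler_poweR; rewrite ?in_itv/= ?leey ?andbT//.
  - by rewrite divr_ge0// ltW.
  - by rewrite lee_fin divr_ge0 ?(ltW q1)// exprn_ge0// powR_ge0.
  - exact: square_sum_le.
rewrite integral_cst; last exact: measurable_triadic.
rewrite powRM ?exprn_ge0 ?powR_ge0// ?invr_ge0 ?(ltW q1)//.
rewrite -powR_mulrn ?powR_ge0// -!powRrM.
(* The exponents of 2/3 combine to n. *)
rewrite (_ : 2 / p * (n%:R * (p / 2)) = n%:R); last by field; rewrite gt_eqF.
rewrite powR_mulrn// mulrC EFinM -muleA [2^-1 * p]mulrC.
apply: lee_wpmul2l; rewrite ?lee_fin ?powR_ge0//.
rewrite muleC; exact: cantor_law_le_mu01.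
Qed.

(** * Integrability of the gap function *)

(** Terms 2n and 2n+1 are both bounded by the term 2n. *)
Lemma sum_doubling_le {R : realType} (a : nat -> R) N :
  (forall n, (0 < n)%N -> a n.+1 <= a n) ->
  \sum_(1 <= n < N.+1.*2) a n <= a 1 + \sum_(1 <= n < N.+1) a n.*2 *+ 2.
Proof.
move=> ad; elim: N => [|N IH].
  by rewrite big_nat1 [X in _ + X]big_geq// addr0.
rewrite doubleS big_nat_recr//= big_nat_recr//= [in leRHS]big_nat_recr//=.
by have := ad N.+1.*2 isT; rewrite mulr2n; lra.
Qed.

(** Doubling gives S <= 1 + q S for the partial sums S, with
    q = 2^(1-s) < 1, so S <= 1 / (1 - q). *)
Lemma sum_powRN_bounded {R : realType} (s : R) : 1 < s ->
  exists M : R, forall N, \sum_(1 <= n < N) n%:R `^ (- s) <= M.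
Proof.
move=> s1; pose q : R := 2 `^ (1 - s).
have q1 : q < 1.
  rewrite /q -opprB powRN invf_lt1 ?powR_gt0//.
  suff : 1 `^ (s - 1) < (2 : R) `^ (s - 1) by rewrite powR1.
  by apply: gt0_ltr_powR; rewrite ?subr_gt0 ?nnegrE// ltr1n.
exists (1 - q)^-1; have a0 n : 0 <= (n%:R : R) `^ (- s) by exact: powR_ge0.
have ad n : (0 < n)%N -> (n.+1%:R : R) `^ (- s) <= n%:R `^ (- s).
  move=> n0; rewrite !powRN lef_pV2 ?posrE ?powR_gt0 ?ltr0n//.
  by rewrite ge0_ler_powR ?nnegrE ?ler_nat// ltW// (lt_trans ltr01).
move=> [|N]; first by rewrite big_geq// invr_ge0 subr_ge0 ltW.
set S := \sum_(_ <= _ < _) _.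
have SM : S <= 1 + q * S.
  have le2 : S <= \sum_(1 <= n < N.+1.*2) (n%:R : R) `^ (- s).
    rewrite [leRHS](@big_cat_nat _ _ _ N.+1)//=; last by rewrite -addnn leq_addr.
    by rewrite lerDl sumr_ge0.
  apply: le_trans le2 (le_trans (sum_doubling_le N ad) _).
  rewrite powR1 lerD2l mulr_sumr; apply: ler_sum_nat => n /andP[n0 _].
  rewrite -mul2n natrM powRM// -[leLHS]mulr_natl.
  by rewrite /q powRD ?pnatr_eq0 ?implybT// powRr1// mulrA.
by rewrite -[leRHS]mul1r ler_pdivlMr ?subr_gt0// mulrBr mulr1 lerBlDr mulrC.
Qed.

Definition gap_value {R : realType} (p rho : R) (n : nat) : R :=
  (3 / 2) `^ (n%:R / p) * n%:R `^ (- rho).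

Lemma gap_value_ge0 {R : realType} (p rho : R) n : 0 <= gap_value p rho n.
Proof. by rewrite mulr_ge0 ?powR_ge0. Qed.

Lemma cantor_gap_inj {R : realType} (x : R) m n :
  cantor_gap m x -> cantor_gap n x -> m = n.
Proof.
wlog mn : m n / (m < n)%N => [H xm xn|[_ xm] [xn _]].
  by case: (ltngtP m n) => // mn; [exact: H|apply/esym/H].
case: xm; apply: cantor_approx_le xn.
by rewrite -ltnS prednK// (leq_ltn_trans _ mn).
Qed.

Lemma gap_fun_cvg_in {R : realType} (p rho x : R) m :
  (0 < m)%N -> cantor_gap m x ->
  \sum_(1 <= n < N) gap_value p rho n * \1_(cantor_gap n) x @[N --> \oo]
    --> gap_value p rho m.
Proof.
move=> m0 xm; apply: cvg_near_cst; exists m.+1 => // N /= mN.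
rewrite (bigD1_seq m) ?mem_index_iota ?m0 ?iota_uniq//=.
rewrite indicE mem_set// mulr1 big1 ?addr0// => n nm.
rewrite indicE memNset ?mulr0// => xn.
by rewrite (cantor_gap_inj xn xm) eqxx in nm.
Qed.

Lemma gap_fun_cvg_out {R : realType} (p rho x : R) :
  (forall m, (0 < m)%N -> ~ cantor_gap m x) ->
  \sum_(1 <= n < N) gap_value p rho n * \1_(cantor_gap n) x @[N --> \oo]
    --> (0 : R).
Proof.
move=> xm; apply: cvg_near_cst; exists 0%N => // N _.
rewrite big_nat_cond big1// => n /andP[/andP[n0 _] _].
by rewrite indicE memNset ?mulr0//; exact: xm.
Qed.

Lemma gap_fun_in {R : realType} (p rho x : R) m : (0 < m)%N -> cantor_gap m x ->
  gap_fun p rho x = gap_value p rho m.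
Proof. by move=> m0 xm; exact/cvg_lim/gap_fun_cvg_in. Qed.

(** Case analysis on the value of the function at x: the gaps are pairwise
    disjoint, so the defining sums are eventually constant. *)
Variant gap_fun_spec {R : realType} (p rho x : R) : R -> Prop :=
| GapIn m of (0 < m)%N & cantor_gap m x :
    gap_fun_spec p rho x (gap_value p rho m)
| GapOut of (forall m, (0 < m)%N -> ~ cantor_gap m x) :
    gap_fun_spec p rho x 0.

Lemma gap_funP {R : realType} (p rho x : R) :
  gap_fun_spec p rho x (gap_fun p rho x).
Proof.
have [[m [m0 xm]]|nex] := pselect (exists m, (0 < m)%N /\ cantor_gap m x).
  by rewrite (gap_fun_in p rho m0 xm); exact: GapIn.
have xout m : (0 < m)%N -> ~ cantor_gap m x.
  by move=> m0 xm; apply: nex; exists m.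
rewrite (_ : gap_fun p rho x = 0); first exact: GapOut.
exact/cvg_lim/gap_fun_cvg_out.
Qed.

Lemma gap_fun_ge0 {R : realType} (p rho x : R) : 0 <= gap_fun p rho x.
Proof. by case: gap_funP => // m _ _; exact: gap_value_ge0. Qed.

Lemma measurable_gap_fun {R : realType} (p rho : R) :
  measurable_fun setT (gap_fun p rho : measurableTypeR R -> measurableTypeR R).
Proof.
apply: (@measurable_fun_cvg _ _ _ _
  (fun N x => \sum_(1 <= n < N) gap_value p rho n * \1_(cantor_gap n) x)) =>
  [N|x _].
  apply: measurable_sum => n; apply: measurable_funM => //.
  by apply: measurable_indic; exact: measurable_cantor_gap.
rewrite -/(gap_fun p rho x); case: (gap_funP p rho x) => [m m0 xm|xout].
  exact: gap_fun_cvg_in.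
exact: gap_fun_cvg_out.
Qed.

(** Bounding by a series of indicators lets the integral be computed gap by
    gap. *)
Lemma gap_fun_powR_le {R : realType} (p rho x : R) : 0 < p ->
  ((gap_fun p rho x `^ p)%:E <=
   \sum_(n <oo) (gap_value p rho n.+1 `^ p * \1_(cantor_gap n.+1) x)%:E)%E.
Proof.
move=> p0.
have t0 n : (0 <= (gap_value p rho n.+1 `^ p * \1_(cantor_gap n.+1) x)%:E)%E.
  by rewrite lee_fin mulr_ge0 ?powR_ge0.
case: gap_funP => [[//|m] _ xm|_].
  apply: le_trans (nneseries_lim_ge m.+1 _) => [|n _ _]; last exact: t0.
  rewrite big_nat_recr//= indicE mem_set// mulr1.
  by apply: leeDr; exact: sume_ge0.
rewrite powR0 ?gt_eqF//; apply: nneseries_ge0 => n _ _; exact: t0.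
Qed.

Lemma gap_value_powR {R : realType} (p rho : R) n : 0 < p ->
  gap_value p rho n `^ p = (3 / 2) ^+ n * n%:R `^ (- (rho * p)).
Proof.
move=> p0; rewrite /gap_value powRM ?powR_ge0// -!powRrM mulNr.
by rewrite divfK ?gt_eqF// powR_mulrn.
Qed.

(** The gap of generation n has measure at most (2/3)^(n-1), which cancels the
    factor (3/2)^n of the p-th power of the function there; what remains is the
    series of n^(- rho p), convergent as rho p > 1. *)
Lemma gap_fun_Lfun {R : realType} (p rho : R) : 0 < p -> p^-1 < rho ->
  gap_fun p rho \in Lfun (@mu01 R) p%:E.
Proof.
move=> p0 prho; have mf := measurable_gap_fun p rho.
rewrite inE; apply/andP; split; rewrite inE//= /finite_norm unlock.
apply: poweR_lty.
have [|M MP] := @sum_powRN_bounded R (rho * p).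
  by rewrite -ltr_pdivrMr// mul1r.
apply: le_lt_trans (_ : (3 / 2 * M)%:E < +oo)%E; last exact: ltry.
apply: le_trans (_ : (\int[mu01]_x
    \sum_(n <oo) (gap_value p rho n.+1 `^ p * \1_(cantor_gap n.+1) x)%:E <= _)%E).
  apply: le_ge0_integral => x _; first exact: poweR_ge0.
  by rewrite /= ger0_norm ?gap_fun_ge0//; exact: gap_fun_powR_le.
rewrite integral_nneseries//; first last.
- by move=> n x _; rewrite lee_fin mulr_ge0 ?powR_ge0.
- move=> n; apply/measurable_EFinP; apply: measurable_funM => //.
  by apply: measurable_indic; exact: measurable_cantor_gap.
apply: lime_le.
  apply: is_cvg_nneseries => n _ _; apply: integral_ge0 => x _.
  by rewrite lee_fin mulr_ge0 ?powR_ge0.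
apply: nearW => N.
apply: le_trans (_ : (\sum_(0 <= n < N)
    (3 / 2 * n.+1%:R `^ (- (rho * p)))%:E <= _)%E).
  apply: lee_sum => n _.
  under eq_integral do rewrite EFinM.
  rewrite ge0_integralZl_EFin ?powR_ge0//; last first.
    apply/measurable_EFinP; apply: measurable_indic.
    exact: measurable_cantor_gap.
  rewrite integral_indic//; last exact: measurable_cantor_gap.
  rewrite setIT gap_value_powR//.
  apply: le_trans (_ : (_ * ((2 / 3) ^+ n)%:E <= _)%E).
    apply: lee_wpmul2l; first by rewrite lee_fin mulr_ge0 ?exprn_ge0 ?powR_ge0.
    apply: le_trans (mu01_cantor_approx n).
    apply: le_measure; rewrite ?inE; last by move=> x [].
      exact: measurable_cantor_gap.
    exact: measurable_cantor_approx.
  (* (3/2)^(n+1) (2/3)^n = 3/2 *)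
  rewrite -EFinM lee_fin le_eqVlt; apply/orP; left; apply/eqP.
  rewrite mulrAC exprS -(mulrA (3 / 2)) -exprMn.
  by rewrite (_ : 3 / 2 * (2 / 3) = 1) ?expr1n ?mulr1//; field.
rewrite sumEFin lee_fin -mulr_sumr ler_pM2l; last lra.
by have := MP N.+1; rewrite big_add1.
Qed.

(** * Divergence of the square function *)

Lemma gap_fun_integrable {R : realType} (p rho : R) : 1 <= p -> p^-1 < rho ->
  (@mu01 R).-integrable setT (EFin \o gap_fun p rho).
Proof.
move=> p1 prho; have p0 : 0 < p by exact: lt_le_trans p1.
apply/Lfun1_integrable; apply: Lfun_subset (gap_fun_Lfun p0 prho) => //.
rewrite /= /mu01 /mrestr setTI lebesgue_measure_itv/= lte_fin ltr01.
by rewrite oppr0 adde0.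
Qed.

(** The middle third of a constituent of generation n lies in the gap of
    generation n.+1 and carries one third of the measure. *)
Lemma average_gap_fun_ge {R : realType} (p rho : R) n k :
  1 <= p -> p^-1 < rho -> k \in cantor_index n ->
  gap_value p rho n.+1 / 3 <= average mu01 (gap_fun p rho) (triadic (n%:Z, k)).
Proof.
move=> p1 prho kn; have muI := @mu01_triadic R n k kn.
have n3 : 0 < (3 : R) ^+ n by exact: exprn_gt0.
rewrite /average/= muI eqe invr_eq0 gt_eqF//= invrK.
pose M : set R := triadic (n%:Z + 1, 3 * k + 1).
have MI : M `<=` triadic (n%:Z, k) by exact: triadic_child.
have MC : M `<=` cantor_gap n.+1.
  move=> x /[dup] /MI /triadicE xI.
  rewrite /M (_ : n%:Z + 1 = n.+1%:Z); last lia.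
  move=> /triadicE xM; split => /=.
    by apply/cantor_approxE; rewrite exprnP xI.
  by move=> /cantor_approxE; rewrite exprnP xM cantor_indexS => /andP[_]; lia.
have muM : mu01 M = (3 ^- n.+1)%:E.
  rewrite /M (_ : n%:Z + 1 = n.+1%:Z); last lia.
  rewrite mu01_triadic_itv ?exprnN//.
  rewrite -cantor_approx0 (_ : n.+1%:Z = n%:Z + 1); last lia.
  apply: subset_trans MC (subset_trans _ (cantor_approx_le (leq0n n))).
  by move=> x [].
have mI := @measurable_triadic R (n%:Z, k).
have fI : mu01.-integrable (triadic (n%:Z, k)) (EFin \o gap_fun p rho).
  exact: integrableS (gap_fun_integrable p1 prho).
(* one third of the value = length^-1 * value * (length of the middle third) *)
rewrite (_ : _ / 3 = 3 ^+ n * (gap_value p rho n.+1 * 3 ^- n.+1)); last first.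
  by rewrite exprS invfM; field; rewrite gt_eqF.
rewrite ler_pM2l// -lee_fin fineK; last exact: integrable_fin_num.
apply: le_trans (_ : (\int[mu01]_(x in M) (gap_fun p rho x)%:E <= _)%E).
  rewrite (eq_integral (cst (gap_value p rho n.+1)%:E)); last first.
    by move=> x; rewrite inE => /MC xM; rewrite (gap_fun_in p rho _ xM).
  rewrite integral_cst; last exact: measurable_triadic.
  by rewrite /= muM.
apply: ge0_subset_integral => //; first exact: measurable_triadic.
  exact: measurable_int fI.
by move=> x _; rewrite lee_fin; exact: gap_fun_ge0.
Qed.

(** The term of generation n is at least
      ((3/2)^(2/p))^(n+1) (n+1)^(- 2 rho) / 9 * ((2/3)^(2/p))^n
    >= (n+1)^(- 2 rho) / 9 >= 1 / (9 (n+1)),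
    the last step because 2 rho < 1; the harmonic series diverges. *)
Lemma square_function_pinfty {R : realType} (p rho x : R) :
  1 <= p -> p^-1 < rho -> rho < 2^-1 -> (\bigcap_n cantor_approx n) x ->
  (\esum_(I in [set: int * int])
     (`|average mu01 (gap_fun p rho) (triadic I)| ^+ 2
      * `|mdiff_b p I x| ^+ 2)%:E = +oo)%E.
Proof.
move=> p1 prho rho2 xC; have p0 : 0 < p by exact: lt_le_trans p1.
set F := fun I => _.
have F0 I : (0 <= F I)%E by rewrite lee_fin mulr_ge0// exprn_ge0.
have Fge n : ((harmonic n / 9)%:E <= F (triadic_at x n))%E.
  rewrite lee_fin mdiff_b_cantor; last exact: xC.
  have kn : Num.floor (3 ^+ n * x) \in cantor_index n.
    by apply/cantor_approxE; exact: xC.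
  have := average_gap_fun_ge p1 prho kn; rewrite -/(triadic_at x n).
  set a := average _ _ _ => ca; have c0 := gap_value_ge0 p rho n.+1.
  have ca2 : (gap_value p rho n.+1 / 3) ^+ 2 <= `|a| ^+ 2.
    by rewrite lerXn2r ?nnegrE ?divr_ge0// (le_trans ca)// ler_norm.
  apply: le_trans (ler_wpM2r _ ca2); last by rewrite exprn_ge0// powR_ge0.
  rewrite expr_div_n -(natrX R 3 2).
  rewrite mulrAC ler_pM2r ?invr_gt0// /gap_value exprMn powR_divn_sqr.
  rewrite mulrAC exprS -(mulrA (_ `^ (2 / p))) -exprMn -powRM//.
  rewrite (_ : 3 / 2 * (2 / 3) = 1); last by field.
  rewrite powR1 expr1n mulr1 -[leLHS]mul1r ler_pM ?harmonic_ge0//.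
    suff : (3 / 2) `^ 0 <= (3 / 2) `^ (2 / p) by rewrite powRr0.
    by rewrite ler_powR ?divr_ge0 ?(ltW p0)//; lra.
  rewrite -powR_mulrn ?powR_ge0// -powRrM /harmonic/= -powR_inv1// ler_powR//.
    by rewrite ler1n.
  lra.
rewrite (@esum_triadic_at _ x) => //; last first.
  move=> I; rewrite eqe mulf_eq0 negb_or => /andP[_].
  by rewrite sqrf_eq0 normr_eq0 => /mdiff_b_neq0.
under eq_eseriesl do rewrite in_setT.
apply/eqP; apply: contraT => S_fin; exfalso; apply: (@dvg_harmonic R).
have S0 : (0 <= \sum_(n <oo) F (triadic_at x n))%E by exact: nneseries_ge0.
move: S_fin; case SE : (\sum_(n <oo) F (triadic_at x n))%E S0 => [r| |]// r0 _.
apply: nondecreasing_is_cvgn.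
  by apply: nondecreasing_series => n _ _; exact: harmonic_ge0.
(* A finite sum r would bound the partial sums of the harmonic series by 9 r. *)
exists (9 * r) => _ [N _ <-]; rewrite -ler_pdivrMl// /series/= mulr_sumr.
rewrite -lee_fin -SE -sumEFin.
apply: le_trans (nneseries_lim_ge N _) => //.
by apply: lee_sum => n _; rewrite mulrC; exact: Fge.
Qed.

(** The integrand is infinite on the Cantor set, which has full
    nu-measure. *)
Lemma square_function_integral_pinfty {R : realType}
    (nu : probability (measurableTypeR R) R) (p rho : R) :
  cantor_law nu -> 1 <= p -> p^-1 < rho -> rho < 2^-1 ->
  (\int[nu]_x
     (\esum_(I in [set: int * int])
        (`|average mu01 (gap_fun p rho) (triadic I)| ^+ 2
         * `|mdiff_b p I x| ^+ 2)%:E) `^ (p / 2) = +oo)%E.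
Proof.
move=> nuC p1 prho rho2; apply/eqP; rewrite -leye_eq.
have mC : measurable (\bigcap_n cantor_approx n : set (measurableTypeR R)).
  by apply: bigcapT_measurable => n; exact: measurable_cantor_approx.
rewrite -[leLHS](_ : (\int[nu]_(x in \bigcap_n cantor_approx n) +oo = _)%E);
  last first.
  by rewrite (integral_cst nu mC) [X in (_ * X)%E](cantor_law_bigcap nuC) mule1.
rewrite integral_mkcond; apply: le_ge0_integral => x _.
  by apply: erestrict_ge0 => y _; exact: leey.
rewrite patchE; case: ifPn => [|_]; last exact: poweR_ge0.
rewrite inE => xC; rewrite square_function_pinfty// poweRyr//.
by rewrite gt_eqF// divr_gt0// (lt_le_trans ltr01).
Qed.

Theorem claim3p1 (R : realType) (nu : probability (measurableTypeR R) R)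
    (p rho : R) :
  cantor_law nu -> 2 < p -> p^-1 < rho -> rho < 2^-1 ->
  [/\ exists2 B : R, 0 <= B &
        forall J : int * int,
          (\int[nu]_(x in triadic J)
             (\esum_(I in [set I | (triadic I : set R) `<=` triadic J])
                (`|mdiff_b p I x| ^+ 2)%:E) `^ (p / 2)
           <= (B `^ p)%:E * mu01 (triadic J))%E,
      gap_fun p rho \in Lfun (@mu01 R) p%:E,
      (\int[nu]_x
         (\esum_(I in [set: int * int])
            (`|average mu01 (gap_fun p rho) (triadic I)| ^+ 2
             * `|mdiff_b p I x| ^+ 2)%:E) `^ (p / 2) = +oo)%E &
      ~ exists2 A : R, 0 <= A &
          forall g : R -> R, g \in Lfun (@mu01 R) p%:E ->
            (\int[nu]_x
               (\esum_(I in [set: int * int])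
                  (`|average mu01 g (triadic I)| ^+ 2
                   * `|mdiff_b p I x| ^+ 2)%:E) `^ (p / 2)
             <= (A `^ p)%:E * 'N[mu01]_p%:E[EFin \o g] `^ p)%E].
Proof.
move=> nuC p2 prho rho2; have p0 : 0 < p by lra.
have p1 : 1 <= p by lra.
have fL := gap_fun_Lfun p0 prho.
have Sy := square_function_integral_pinfty nuC p1 prho rho2.
split=> //; first exact: testing_condition.
move=> [A A0 /(_ _ fL)]; rewrite Sy leye_eq => /eqP Ny.
have : ('N[mu01]_p%:E[EFin \o gap_fun p rho] < +oo)%E.
  by move: fL; rewrite inE => /andP[_]; rewrite inE.
move=> /(poweR_lty p) Nfin.
have : ((A `^ p)%:E * 'N[mu01]_p%:E[EFin \o gap_fun p rho] `^ p < +oo)%E.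
  by rewrite lte_mul_pinfty ?lee_fin ?powR_ge0.
by rewrite Ny ltxx.
Qed.
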